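(* If $G$ is an $r$-regular graph of order $n\ge 8$ with $r\ge 1$, then the graphs $\mathcal{L}^k\big(\overline{\mathcal{L}(G)}\big)$ have property $\varrho$ for every $k\ge 1$.
   Context: $\mathcal{L}(G)$ is the line graph of $G$ and $\overline{X}$ the complement of $X$; $\mathcal{L}^k$ is the $k$-th iterated line graph. A graph has property $\varrho$ if all its negative adjacency eigenvalues equal $-2$. *)

(* Defs.v *)
From HB Require Import structures.
From mathcomp Require Import all_boot all_order all_algebra.
From mathcomp Require Import reals.
Set Implicit Arguments.
Unset Strict Implicit.
Unset Printing Implicit Defensive.
Import Order.TTheory GRing.Theory Num.Theory.
Local Open Scope ring_scope.

(* Finite simple graphs, bundled with their vertex type because the line graph
   operator, which is iterated, changes that type. *)
Record sgraph := SGraph {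
  vertex :> finType;
  adj : rel vertex;
  adj_sym : symmetric adj;
  adj_irrefl : irreflexive adj }.

Definition graph_order (G : sgraph) : nat := #|G|.

Definition degree (G : sgraph) (x : G) : nat := #|[set y | adj x y]|.

Definition regular (r : nat) (G : sgraph) : Prop :=
  forall x : G, degree x = r.

Section Complement.
Variable G : sgraph.

Definition compl_adj : rel G := fun x y => (x != y) && ~~ adj x y.

Lemma compl_adj_sym : symmetric compl_adj.
Proof. by move=> x y; rewrite /compl_adj eq_sym adj_sym. Qed.

Lemma compl_adj_irrefl : irreflexive compl_adj.
Proof. by move=> x; rewrite /compl_adj eqxx. Qed.

Definition complement : sgraph := SGraph compl_adj_sym compl_adj_irrefl.
End Complement.

Section LineGraph.
Variable G : sgraph.

Definition edges : {set {set G}} :=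
  [set [set x; y] | x in [set: G], y in [set: G] & adj x y].

Definition edge : finType := {e : {set G} | e \in edges}.

Definition line_adj : rel edge :=
  fun e f => (e != f) && (val e :&: val f != set0).

Lemma line_adj_sym : symmetric line_adj.
Proof. by move=> e f; rewrite /line_adj eq_sym setIC. Qed.

Lemma line_adj_irrefl : irreflexive line_adj.
Proof. by move=> e; rewrite /line_adj eqxx. Qed.

Definition line_graph : sgraph := SGraph line_adj_sym line_adj_irrefl.
End LineGraph.

Definition iter_line_graph (k : nat) (G : sgraph) : sgraph :=
  iter k line_graph G.

Definition adjacency_mx (R : realType) (G : sgraph) : 'M[R]_#|G| :=
  \matrix_(i, j) (adj (enum_val i) (enum_val j))%:R.

Definition property_rho (R : realType) (G : sgraph) : Prop :=
  forall a : R, eigenvalue (adjacency_mx R G) a -> a < 0 -> a = - 2%:R.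

(* Main.v *)
(** Incidence counting turns an eigenfunction of the line graph of a [d]-regular
    graph [H], with eigenvalue [a <> -2], into an eigenfunction of [H] with
    eigenvalue [a + 2 - d], and shows that no line graph has an eigenvalue below
    [-2].  So the claim for [L(H)] amounts to [H] having least eigenvalue at least
    [2 - d].  For [H] the complement of [L(G)] the least eigenvalue is at least
    [1 - 2 r] while [d = n r / 2 - 2 r + 1 >= 2 r + 1].  For [H] the line graph of
    a regular graph of degree [c >= 3], it is at least [-2], and
    [d = 2 c - 2 >= 4]; this handles all further iterates. *)
Require Import Defs.
From mathcomp Require Import all_boot all_order all_algebra.
From mathcomp Require Import reals.
From mathcomp Require Import zify lra.

Section LineGraphSpectrum.

Set Implicit Arguments.
Unset Strict Implicit.
Unset Printing Implicit Defensive.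
Import Order.TTheory GRing.Theory Num.Theory.
Local Open Scope ring_scope.

(** * Incidence between vertices and edges *)

Section Incidence.
Variable G : sgraph.
Implicit Types (x y z : G) (e f : edge G).

Lemma edgeP (A : {set G}) :
  reflect (exists x y, adj x y /\ A = [set x; y]) (A \in edges G).
Proof.
apply: (iffP imset2P) => [[x y _]|[x [y [xy ->]]]].
  by rewrite inE => /andP[_ xy] ->; exists x, y.
by exists x y => //; rewrite !inE.
Qed.

Lemma card_edge e : #|val e| = 2%N.
Proof.
case/edgeP: (valP e) => x [y [xy ->]]; rewrite cards2.
by case: eqP xy => // ->; rewrite adj_irrefl.
Qed.

Lemma card_edgeI e f : e != f -> #|val e :&: val f| = line_adj e f.
Proof.
move=> ef; rewrite /line_adj ef /= -card_gt0.
have : (#|val e :&: val f| < 2)%N.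
  rewrite ltnNge; apply: contra ef => ef2; apply/eqP/val_inj/eqP.
  have /eqP <- : val e :&: val f == val e.
    by rewrite eqEcard subsetIl card_edge.
  by rewrite eqEcard subsetIr card_edge.
by case: #|_| => [|[]].
Qed.

Lemma card_edges2 x y :
  x != y -> #|[pred e : edge G | (x \in val e) && (y \in val e)]| = adj x y.
Proof.
move=> xy.
have eqxy e : (x \in val e) && (y \in val e) = (val e == [set x; y]).
  by rewrite eq_sym eqEcard cards2 xy card_edge andbT subUset !sub1set.
case: (boolP (adj x y)) => [axy|nxy].
  have exy : [set x; y] \in edges G by apply/edgeP; exists x, y.
  transitivity #|pred1 (exist (fun A => A \in edges G) _ exy : edge G)|; last exact: card1.
  by apply: eq_card => e; rewrite !inE eqxy.
apply: eq_card0 => e; rewrite !inE eqxy; apply: contraNF nxy => /eqP exy.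
case/edgeP: (valP e) => u [v [uv]]; rewrite exy => /setP xyuv.
move: (xyuv x) (xyuv y); rewrite !inE !eqxx orbT /=.
move=> /esym/orP[]/eqP xE /esym/orP[]/eqP yE; subst => //.
- by rewrite eqxx in xy.
- by rewrite adj_sym.
- by rewrite eqxx in xy.
Qed.

(** Two distinct vertices lie in at most one common edge, so exchanging the sums meets each
    neighbour of [x] once. Values in an [nmodType] cover both degree counts in [nat] and real
    eigenfunctions. *)
Lemma sum_incident_vertex (V : nmodType) (g : G -> V) x :
  \sum_(e : edge G | x \in val e) \sum_(z in val e | z != x) g z =
  \sum_(z | adj x z) g z.
Proof.
rewrite (exchange_big_dep (fun z => z != x)) /=; last by move=> e z _ /andP[].
rewrite [RHS]big_mkcond [LHS]big_mkcond; apply: eq_bigr => z _.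
have [->|zx] /= := eqVneq z x; first by rewrite adj_irrefl.
under eq_bigl do rewrite andbT.
by rewrite sumr_const card_edges2 1?eq_sym //; case: adj.
Qed.

Lemma card_incident x : #|[pred e : edge G | x \in val e]| = degree x.
Proof.
rewrite /degree cardsE -!sum1_card -[RHS](sum_incident_vertex (fun=> 1%N)).
apply: eq_bigr => e; rewrite inE => xe.
rewrite sum1_card; have := card_edge e; rewrite (cardD1 x) xe => -[/esym] ->.
by apply: eq_card => z; rewrite !inE andbC.
Qed.

(** With B the vertex-edge incidence matrix and D the diagonal of degrees, this is B B^T = D +
    A(G). *)
Lemma sum_incident_edge (V : nmodType) (g : G -> V) x :
  \sum_(e : edge G | x \in val e) \sum_(z in val e) g z =
  g x *+ degree x + \sum_(z | adj x z) g z.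
Proof.
rewrite -sum_incident_vertex -card_incident -sumr_const -big_split /=.
by apply: eq_bigr => e xe; rewrite (bigD1 x).
Qed.

(** The companion identity B^T B = 2 I + A(L(G)): an edge has two ends, and distinct edges share at
    most one. *)
Lemma sum_edge_incident (V : nmodType) (F : edge G -> V) e :
  \sum_(x in val e) \sum_(f : edge G | x \in val f) F f =
  F e *+ 2 + \sum_(f : edge G | line_adj e f) F f.
Proof.
rewrite (exchange_big_dep predT) //= (bigD1 e) //=; congr (_ + _).
  rewrite sumr_const -(card_edge e); congr (_ *+ _).
  by apply: eq_card => x; exact: andbb.
rewrite [RHS]big_mkcond [LHS]big_mkcond; apply: eq_bigr => f _.
have [->|fe] /= := eqVneq f e; first by rewrite line_adj_irrefl.
rewrite sumr_const; transitivity (F f *+ line_adj e f); last by case: line_adj.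
rewrite -card_edgeI 1?eq_sym //; congr (_ *+ _).
by apply: eq_card => x; rewrite !inE.
Qed.

Lemma handshake r : regular r G -> (#|edge G| * 2 = #|G| * r)%N.
Proof.
move=> rG; rewrite -!sum_nat_const.
rewrite -(eq_bigr _ (fun e _ => card_edge e)).
under eq_bigr do rewrite -sum1_card.
rewrite (exchange_big_dep predT) //=; apply: eq_bigr => x _.
by rewrite sum1_card card_incident rG.
Qed.

Lemma line_graph_regular r : regular r G -> regular (r * 2 - 2) (line_graph G).
Proof.
(* The constant function 1 gives 2 r = 2 + degree, so the truncated subtraction is exact. *)
move=> rG e; have := sum_edge_incident (fun=> 1%N) e.
under eq_bigr do rewrite sum1_card card_incident rG.
rewrite sum_nat_const card_edge sum1_card /degree cardsE.
rewrite (_ : 1%N *+ 2 + _ = (2 + #|line_adj e|)%N) // mulnC => ->.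
by rewrite addKn.
Qed.

Lemma sum_complement (V : nmodType) (g : G -> V) x :
  \sum_(y | compl_adj x y) g y + \sum_(y | adj x y) g y + g x = \sum_y g y.
Proof.
rewrite [RHS](bigD1 x) //= [RHS]addrC; congr (_ + _).
rewrite [RHS](bigID (adj x)) /= addrC; congr (_ + _); apply: eq_bigl => y.
  by rewrite /compl_adj eq_sym.
by have [->|_] := eqVneq y x; rewrite ?adj_irrefl.
Qed.

Lemma complement_regular s :
  regular s G -> regular (#|G| - s.+1) (complement G).
Proof.
move=> sG x; have := sum_complement (fun=> 1%N) x.
rewrite !sum1_card -(sG x) /degree !cardsE.
rewrite -[LHS]/(_ + #|@adj G x| + 1)%N => <-.
by rewrite -addnA addn1 addnK.
Qed.

End Incidence.

(** * Eigenvalue bounds for regular graphs and their complements *)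

Section Eigenfunctions.
Variable R : realType.

(** Functions on vertices replace row vectors over enumeration indices, so the incidence identities
    apply directly. *)
Definition eigenfun (G : sgraph) (a : R) (g : G -> R) : Prop :=
  (exists x, g x != 0) /\ forall x, \sum_(y | adj x y) g y = a * g x.

Lemma eigenvalue_eigenfun (G : sgraph) (a : R) :
  eigenvalue (adjacency_mx R G) a -> exists g : G -> R, eigenfun a g.
Proof.
case/eigenvalueP => v vA v0; exists (fun x => v 0 (enum_rank x)); split.
  have /existsP[i vi] : [exists i, v 0 i != 0].
    apply: contraNT v0 => /existsPn v0.
    by apply/eqP/rowP => i; rewrite mxE; apply/eqP/negPn/v0.
  by exists (enum_val i); rewrite enum_valK.
move=> x; have /rowP/(_ (enum_rank x)) := vA; rewrite !mxE => <-.
rewrite (reindex enum_rank) /=; last first.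
  by apply: onW_bij; exact: enum_rank_bij.
rewrite big_mkcond; apply: eq_bigr => y _.
by rewrite mxE !enum_rankK adj_sym; case: adj; rewrite ?mulr1 ?mulr0.
Qed.

(** Compare both sides of the eigenvalue equation at a vertex where [|g|] is largest. *)
Lemma regular_eigenfun_le (G : sgraph) (s : nat) (a : R) (g : G -> R) :
  regular s G -> eigenfun a g -> a <= s%:R.
Proof.
move=> sG [[x0 gx0] ag].
have [x _ gx] := @Order.TotalTheory.arg_maxP _ _ G x0 predT (fun x => `|g x|) isT.
have gx_gt0 : 0 < `|g x| by rewrite (lt_le_trans _ (gx x0 isT)) // normr_gt0.
apply: le_trans (ler_norm a) _; rewrite -(ler_pM2r gx_gt0) -normrM -ag.
apply: le_trans (ler_norm_sum _ _ _) _.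
apply: le_trans (_ : \sum_(y | adj x y) `|g x| <= _).
  by apply: ler_sum => y _; exact: gx.
by rewrite sumr_const -(sG x) /degree cardsE mulr_natl.
Qed.

(* Either [g] sums to zero, and then it is an eigenfunction of [G], or [a] is the
   degree of the complement. *)
Lemma complement_eigenfun_ge (G : sgraph) (s : nat) (a : R)
    (g : complement G -> R) :
  regular s G -> eigenfun a g -> - (s.+1)%:R <= a.
Proof.
move=> sG [g0 ag]; pose S : R := \sum_x g x.
(* Sum the eigenvalue equation over all vertices: each [g x] occurs once per neighbour of [x] in the
   complement. *)
have dS : (#|G| - s.+1)%:R * S = a * S.
  rewrite /S !mulr_sumr -(eq_bigr _ (fun x _ => ag x)).
  rewrite (exchange_big_dep predT) //=; apply: eq_bigr => x _.
  rewrite -(complement_regular sG x) /degree cardsE mulr_natl -sumr_const.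
  by apply: eq_bigl => y; exact: compl_adj_sym.
have [S0|SN0] := eqVneq S 0; last first.
  by move/(mulIf SN0): dS => <-; apply: le_trans (ler0n _ _); rewrite oppr_le0.
(* As [S] is zero, [g] is an eigenfunction of [G] for -1 - a. *)
suff : - 1 - a <= s%:R by rewrite -natr1; lra.
apply: (@regular_eigenfun_le G s _ g) => //; split=> // x.
have : a * g x + \sum_(y | @adj G x y) g y + g x = 0.
  by rewrite -ag -[RHS]S0; exact: (@sum_complement G R g x).
by lra.
Qed.

(** * Spectrum of line graphs *)

Section LineGraph.
Variables (H : sgraph) (a : R) (F : line_graph H -> R).
Hypothesis aF : eigenfun a F.

Let g (x : H) : R := \sum_(e : edge H | x \in val e) F e.

Let sum_edge_g (e : edge H) : \sum_(x in val e) g x = (a + 2) * F e.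
Proof.
by rewrite sum_edge_incident (proj2 aF e) mulrDl addrC mulr_natl.
Qed.

(** Here [g] is B F and B^T g = (a + 2) F, so [g] cannot vanish; applying B once more gives (d + A)
    g = (a + 2) g. *)
Lemma line_eigenfun (d : nat) :
  regular d H -> a != - 2 -> eigenfun (a + 2 - d%:R) g.
Proof.
move=> dH aN2; have a2 : a + 2 != 0 by rewrite addr_eq0.
split; last first.
  move=> x; have := sum_incident_edge g x.
  under eq_bigr do rewrite sum_edge_g.
  by rewrite -mulr_sumr -/(g x) dH -mulr_natl; lra.
case: aF => -[e Fe] _; have /existsP[x gx] : [exists x, g x != 0]; last by exists x.
apply: contraNT Fe => /existsPn g0.
rewrite -(mulrI_eq0 _ (mulfI a2)) -sum_edge_g big1 // => x _.
exact/eqP/negPn/g0.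
Qed.

(** The sum of the squares of [F], times a + 2, is the sum of the squares of [g]. *)
Lemma line_eigenfun_ge : - 2 <= a.
Proof.
have F2 : 0 < \sum_e F e ^+ 2.
  case: aF => -[e Fe] _; rewrite (bigD1 e) //=.
  apply: ltr_wpDr; first by apply: sumr_ge0 => f _; exact: sqr_ge0.
  by rewrite lt_def sqr_ge0 expf_neq0.
have : 0 <= (a + 2) * \sum_e F e ^+ 2.
  rewrite mulr_sumr.
  under eq_bigr do rewrite expr2 mulrA -sum_edge_g mulr_suml.
  rewrite (exchange_big_dep predT) //=; apply: sumr_ge0 => x _.
  by rewrite -mulr_sumr -/(g x) -expr2 sqr_ge0.
by rewrite pmulr_lge0 //; lra.
Qed.

End LineGraph.

Lemma line_graph_rho (H : sgraph) (d : nat) :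
  regular d H ->
  (forall (b : R) (g : H -> R), eigenfun b g -> 2 - d%:R <= b) ->
  property_rho R (line_graph H).
Proof.
move=> dH Hge a /eigenvalue_eigenfun[F aF] a0.
apply/eqP; apply: contraTT a0 => aN2.
by have := Hge _ _ (line_eigenfun aF dH aN2); lra.
Qed.

(** The inequality on [s] says that the bound -(s + 1) for the complement is at least 2 - d, with d
    its degree. *)
Lemma line_complement_rho (G : sgraph) (s : nat) :
  regular s G -> (s + 3 <= #|G| - s.+1)%N ->
  property_rho R (line_graph (complement G)).
Proof.
move=> sG sd; apply: line_graph_rho (complement_regular sG) _ => b g bg.
have := complement_eigenfun_ge sG bg.
by move: sd; rewrite -(ler_nat R) natrD -natr1; lra.
Qed.

(** From the second iterate on, the outermost line graph is taken of a line graph. Degrees stay at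
    least 3, since c >= 3 gives 2 c - 2 >= 4. *)
Lemma iter_line_graph_rho (H : sgraph) (d k : nat) :
  regular d H -> (3 <= d)%N -> property_rho R (iter_line_graph k.+2 H).
Proof.
move=> dH d3; have [c [c3 cH]] : exists c, (3 <= c)%N /\
    regular c (iter_line_graph k H).
  elim: k => [|k [c [c3 cH]]]; first by exists d.
  exists (c * 2 - 2)%N; split; [lia | exact: line_graph_regular].
apply: line_graph_rho (line_graph_regular cH) _ => b F bF.
have : 4 <= (c * 2 - 2)%:R :> R by rewrite ler_nat; lia.
by have := line_eigenfun_ge bF; lra.
Qed.

End Eigenfunctions.

End LineGraphSpectrum.

Theorem theorem4p18 (R : realType) (G : sgraph) (n r : nat)
    (hn : graph_order G = n) (hn8 : 8 <= n)
    (hG : regular r G) (hr : 1 <= r) (k : nat) (hk : 1 <= k) :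
  property_rho R (iter_line_graph k (complement (line_graph G))).
Proof.
have LG := line_graph_regular hG; have HG := complement_regular LG.
(* Since n >= 8, there are n r / 2 >= 4 r edges, and 4 r - (2 r - 1) = 2 r + 1; equality holds at n
   = 8. *)
have d_ge : r * 2 - 2 + 3 <= #|line_graph G| - (r * 2 - 2).+1.
  have := handshake hG; rewrite -[#|G|]/(graph_order G) hn.
  rewrite -[#|line_graph G|]/#|edge G|; nia.
case: k hk => [//|[_|k _]]; first exact: line_complement_rho LG d_ge.
by apply: iter_line_graph_rho HG _; apply: leq_trans d_ge; rewrite addnC.
Qed.
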